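(* Let $G$ be a connected graph with $|V(G)|\geq 2$ and let $v\in V(G)$. Let $G_v^f$ be the graph obtained from $G$ by adding a new vertex $v'$ such that $v$ and $v'$ are false twins. Then $$h(\mathcal{R}(G^f_v)) < \frac{2|\mathcal{R}(G)|}{|\mathcal{R}(G^f_v)|-|\mathcal{R}(G)|}.$$
   Context: Graphs are finite, simple and undirected. Two vertices $u,v$ of a graph are false twins if $N(u)=N(v)$ (open neighborhoods); thus in $G_v^f$ the new vertex $v'$ is adjacent exactly to the neighbors of $v$ in $G$. A search tree $T$ on a connected graph $G$ is a rooted tree with vertex set $V(G)$, defined recursively: the root of $T$ is a chosen vertex $r\in V(G)$, and the children of $r$ are the roots of search trees on each of the connected components of $G-r$. Let $T$ be a search tree on $G$ and let $v$ be a child of $u$ in $T$. The $uv$-rotation transforms $T$ into the search tree $T'$ on $G$ such that: (i) $u$ is a child of $v$ in $T'$; if $u$ is the root of $T$ then $v$ is the root of $T'$, otherwise, if $p$ is the parent of $u$ in $T$, then $p$ is the parent of $v$ in $T'$; (ii) every subtree of $u$ in $T$ other than the one rooted at $v$ remains a subtree of $u$ in $T'$; (iii) each subtree $S$ of $v$ in $T$ becomes a subtree of $u$ in $T'$ if $u$ is adjacent in $G$ to some vertex of $S$, and otherwise remains a subtree of $v$. All other parent-child relations are unchanged. The rotation graph $\mathcal{R}(G)$ is the undirected graph whose vertices are the search trees on $G$, two search trees being adjacent if one is obtained from the other by a single rotation. $|\mathcal{R}(G)|$ denotes its number of vertices. The edge expansion of a graph $H$ is $h(H)=\min |\partial S|/|S|$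 over nonempty $S\subseteq V(H)$ with $|S|\leq |V(H)|/2$, where $\partial S$ is the set of edges with one endpoint in $S$ and the other in $V(H)\setminus S$. *)

(* Defs.v *)
(* Classical logic (boolp) is used only to turn the inductive
   predicate [search_tree_on] into a boolean. *)
From HB Require Import structures.
From mathcomp Require Import all_boot all_order all_algebra.
From mathcomp Require Import boolp.
Set Implicit Arguments.
Unset Strict Implicit.
Unset Printing Implicit Defensive.
Import Order.TTheory GRing.Theory Num.Theory.

Record sgraph := SGraph {
  vertex :> finType;
  adj : rel vertex;
  adj_sym : symmetric adj;
  adj_irrefl : irreflexive adj }.

Definition neighbors (G : sgraph) (x : G) : {set G} := [set y | adj x y].

Definition connected_graph (G : sgraph) : Prop :=
  forall x y : G, connect (@adj G) x y.

Definition induced_adj (G : sgraph) (A : {set G}) : rel G :=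
  [rel x y | [&& x \in A, y \in A & adj x y]].

Definition components (G : sgraph) (A : {set G}) : {set {set G}} :=
  [set [set y in A | connect (induced_adj A) x y] | x in A].

Definition false_twins (G : sgraph) (x y : G) : Prop :=
  neighbors x = neighbors y.

Section FalseTwin.
Variables (G : sgraph) (v : G).

(* [None] is the new vertex v', and [Some x] is the old vertex x. *)
Definition twin_adj (a b : option G) : bool :=
  match a, b with
  | Some x, Some y => adj x y
  | Some x, None => adj x v
  | None, Some y => adj v y
  | None, None => false
  end.

Lemma twin_adj_sym : symmetric twin_adj.
Proof. by move=> [x|] [y|] //=; apply: adj_sym. Qed.

Lemma twin_adj_irrefl : irreflexive twin_adj.
Proof. by move=> [x|] //=; apply: adj_irrefl. Qed.

Definition add_false_twin : sgraph := SGraph twin_adj_sym twin_adj_irrefl.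

Lemma add_false_twinP : @false_twins add_false_twin (Some v) None.
Proof. by apply/setP => -[x|]; rewrite !inE //= adj_irrefl. Qed.

End FalseTwin.

Section SearchTrees.
Variable G : sgraph.

(* A rooted tree on the vertices of G is encoded by its parent function: the
   root is mapped to [None] and any other vertex x to [Some (parent of x)].
   [search_tree_on p A q] says that p restricted to A is a search tree on the
   subgraph induced by A, whose root has q as its parent. *)
Inductive search_tree_on (p : {ffun G -> option G}) :
    {set G} -> option G -> Prop :=
  SearchTreeOn (A : {set G}) (r : G) of r \in A
    & (forall C, C \in components (A :\ r) -> search_tree_on p C (Some r)) :
  search_tree_on p A (p r).

Definition is_search_tree (p : {ffun G -> option G}) : Prop :=
  search_tree_on p [set: G] None.

Definition search_tree : Type :=
  {p : {ffun G -> option G} | `[< is_search_tree p >]}.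
HB.instance Definition _ := Finite.on search_tree.

Definition subtree (p : {ffun G -> option G}) (x : G) : {set G} :=
  [set y | connect (fun a b => p a == Some b) y x].

(* Meaningful when v is a child of u, i.e. [p v = Some u]. *)
Definition rotate (p : {ffun G -> option G}) (u v : G) :
    {ffun G -> option G} :=
  [ffun x => if x == v then p u
             else if x == u then Some v
             else if (p x == Some v) && [exists y in subtree p x, adj u y]
                  then Some u
             else p x].

Definition is_rotation (p p' : {ffun G -> option G}) : bool :=
  [exists u, exists v, (p v == Some u) && (p' == rotate p u v)].

Definition rotation_adj (T T' : search_tree) : bool :=
  is_rotation (val T) (val T') || is_rotation (val T') (val T).

Lemma rotation_adj_sym : symmetric rotation_adj.
Proof. by move=> T T'; rewrite /rotation_adj orbC. Qed.

Lemma search_tree_on_neq p A q x :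
  search_tree_on p A q -> (forall y, q = Some y -> y \notin A) ->
  x \in A -> p x <> Some x.
Proof.
elim=> {q} {}A r rA _ IH qA xA.
have [-> px|xr] := eqVneq x r; first by move/(_ _ px): qA; rewrite rA.
pose C := [set y in A :\ r | connect (induced_adj (A :\ r)) x y].
have xAr : x \in A :\ r by rewrite !inE xr.
apply: (IH C); first by apply/imsetP; exists x.
  by move=> y [<-]; rewrite !inE eqxx.
by rewrite inE xAr connect0.
Qed.

Lemma rotation_adj_irrefl : irreflexive rotation_adj.
Proof.
move=> [p pP]; rewrite /rotation_adj orbb /=; apply/negbTE/negP.
move=> /existsP[u /existsP[v /andP[/eqP pv /eqP pE]]].
have pvu : p v = p u by rewrite {1}pE ffunE eqxx.
have nloop x : p x <> Some x.
  by apply: (search_tree_on_neq (asboolW pP)) => //; rewrite inE.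
have := pE; move/ffunP/(_ u); rewrite ffunE eqxx.
case: eqP => [uv _|_ pu]; first by apply: (nloop u); rewrite {1}uv.
by apply: (nloop v); rewrite pvu.
Qed.

Definition rotation_graph : sgraph :=
  SGraph rotation_adj_sym rotation_adj_irrefl.

End SearchTrees.

Section EdgeExpansion.
Local Open Scope ring_scope.
Variable H : sgraph.

(* Each edge of the boundary of S is recorded once, oriented out of S. *)
Definition edge_boundary (S : {set H}) : {set H * H} :=
  [set a | [&& a.1 \in S, a.2 \notin S & adj a.1 a.2]].

Definition expansion_ratio (S : {set H}) : rat :=
  #|edge_boundary S|%:R / #|S|%:R.

Definition expansion_set (S : {set H}) : bool :=
  (S != set0) && (2 * #|S| <= #|H|)%N.

(* The default value #|H| bounds every ratio from above, so it does not affect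
   the minimum; see [edge_expansionP]. *)
Definition edge_expansion : rat :=
  \big[Order.min/#|H|%:R]_(S : {set H} | expansion_set S) expansion_ratio S.

Lemma expansion_ratio_le (S : {set H}) :
  expansion_set S -> expansion_ratio S <= #|H|%:R.
Proof.
case/andP; rewrite -card_gt0 => S0 _.
rewrite ler_pdivrMr ?ltr0n // -natrM ler_nat mulnC -cardsT -cardsX.
by apply/subset_leq_card/subsetP => a; rewrite !inE => /and3P[->].
Qed.

Lemma edge_expansionP : (1 < #|H|)%N ->
  (exists2 S : {set H}, expansion_set S & edge_expansion = expansion_ratio S)
  /\ (forall S : {set H}, expansion_set S ->
        edge_expansion <= expansion_ratio S).
Proof.
move=> H1; split; last by move=> S PS; apply: bigmin_le_cond.
have /card_gt0P[x _] : (0 < #|H|)%N by apply: ltnW.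
have Px : expansion_set [set x].
  by rewrite /expansion_set -card_gt0 cards1.
have [S PS E] := eq_bigmin _ _ _ Px expansion_ratio_le.
by exists S.
Qed.

End EdgeExpansion.

(* Main.v *)
Require Import Defs.
From mathcomp Require Import all_boot all_order all_algebra.
From mathcomp Require Import boolp.

Set Implicit Arguments.
Unset Strict Implicit.
Unset Printing Implicit Defensive.

Import Order.TTheory GRing.Theory Num.Theory.

(** Let H be the graph G with the false twin v' of v added, and cut the
    rotation graph of H at the set S of the search trees in which v is a proper
    ancestor of v'.  Exchanging v and v' is an automorphism of H, so there are
    as many trees with v' above v ([card_old_new]); the remaining trees are
    those in which v and v' are incomparable.  If c is the number of these,
    then |R(H)| = 2|S| + c.

    In an incomparable tree v and v' are leaves with the same parent: the tree
    comes from a search tree on G in which v is a leaf, by duplicating this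
    leaf.  A search tree on G with v as its root is not obtained, so
    c < |R(G)| ([incomparable_lt]) and |S| > (|R(H)| - |R(G)|) / 2.

    It remains to see that at most |R(G)| edges leave S ([edge_boundary_le]).
    A rotation alters the subtree of two vertices only, so a rotation that
    leaves S at T' must, read backwards, lift v over its parent in T'
    ([boundary_swap]).  Hence T' determines the edge ([boundary_inj]).
    Moreover, in T' either v and v' are incomparable, or v' is the parent of v
    and then v is the only child of v'.  In both cases removing v' from T'
    leaves a search tree on G ([contract_elimination]), and T' can be recovered
    from it: v is a leaf of the smaller tree in the first case but not in the
    second, and in each case the place of v' is forced ([contract_inj]).  So the
    boundary edges inject into R(G), and h(R(H)) <= |R(G)| / |S| gives the
    bound.  Placing v' as a new root on top of a search tree on G shows that
    |R(G)| <= |S|, so that both denominators are positive.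

    Search trees are handled through the family of their subtrees: a parent
    function is a search tree if and only if it is a rooted tree in which
    adjacent vertices are comparable and every subtree induces a connected
    subgraph ([search_tree_elimination], [elimination_tree_search]). *)

(** * Connectivity in finite graphs *)

Lemma exists_neq (T : finType) (x : T) : 2 <= #|T| -> exists y, y != x.
Proof.
move=> T2; have /card_gt0P[y] : 0 < #|[set: T] :\ x|.
  by move: T2; rewrite -cardsT (cardsD1 x) inE.
by rewrite !inE andbT; exists y.
Qed.

Lemma connect_ind (T : finType) (e : rel T) (P : T -> Prop) (x y : T) :
  P x -> (forall a b, P a -> e a b -> P b) -> connect e x y -> P y.
Proof.
move=> Px clP /connectP[s + ->]; elim: s x Px => //= z s IH x Px.
by case/andP=> /(clP _ _ Px) Pz; apply: IH.
Qed.

Lemma connect_homo (T U : finType) (e : rel T) (e' : rel U) (f : T -> U) :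
  (forall a b, e a b -> connect e' (f a) (f b)) ->
  forall x y, connect e x y -> connect e' (f x) (f y).
Proof.
move=> he x y; apply: (@connect_ind _ e (fun z => connect e' (f x) (f z))).
  exact: connect0.
by move=> a b xa /he; apply: connect_trans.
Qed.

Lemma connect_first_step (T : finType) (e : rel T) (x y : T) :
  connect e x y -> x != y -> exists z, e x z.
Proof.
case/connectP=> [[|z s] /= + ->]; first by rewrite eqxx.
by case/andP=> xz _ _; exists z.
Qed.

Lemma induced_adj_sym (G : sgraph) (A : {set G}) : symmetric (induced_adj A).
Proof. by move=> x y; rewrite /induced_adj /= adj_sym andbCA. Qed.

Lemma connect_induced_sym (G : sgraph) (A : {set G}) :
  connect_sym (induced_adj A).
Proof. exact/sym_connect_sym/induced_adj_sym. Qed.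

Definition component (G : sgraph) (A : {set G}) (x : G) : {set G} :=
  [set y in A | connect (induced_adj A) x y].

Lemma component_eq (G : sgraph) (A : {set G}) x z :
  x \in component A z -> component A x = component A z.
Proof.
rewrite inE => /andP[_ zx]; apply/setP => y; rewrite !inE.
by rewrite (same_connect (@connect_induced_sym G A) zx).
Qed.

Lemma component_connected (G : sgraph) (A : {set G}) x y z :
  x \in A -> y \in component A x -> z \in component A x ->
  connect (induced_adj (component A x)) y z.
Proof.
move=> xA.
have from_x w : w \in component A x ->
    connect (induced_adj (component A x)) x w.
  rewrite inE => /andP[wA xw].
  suff [] : connect (induced_adj A) x w /\
      connect (induced_adj (component A x)) x w by [].
  apply: (connect_ind (P := fun a => connect (induced_adj A) x a /\
      connect (induced_adj (component A x)) x a)) xw => [|a b [xa Ca] ab].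
    by rewrite !connect0.
  have /= /and3P[aA bA adj_ab] := ab.
  have xb : connect (induced_adj A) x b.
    exact: connect_trans xa (connect1 ab).
  split=> //; apply: connect_trans Ca (connect1 _).
  by rewrite /induced_adj /= !inE aA bA xa xb.
move=> /from_x xy /from_x; apply: connect_trans.
by rewrite connect_induced_sym.
Qed.

(** * Subtrees of a parent function *)

Section Subtrees.
Variables (G : sgraph) (p : {ffun G -> option G}).
Implicit Types x y z : G.

Lemma subtree_refl x : x \in subtree p x.
Proof. by rewrite inE connect0. Qed.

Lemma subtree_trans y x z :
  x \in subtree p y -> y \in subtree p z -> x \in subtree p z.
Proof. by rewrite !inE; apply: connect_trans. Qed.

Lemma parent_subtree x y : p x = Some y -> x \in subtree p y.
Proof. by move=> pxy; rewrite inE connect1 //= pxy. Qed.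

(** Subtrees are reached by going down the tree, against the direction of the
    parent function: this is the induction principle that goes with it. *)
Lemma subtree_ind (P : G -> Prop) x y :
  P x -> (forall a b, p a = Some b -> P b -> P a) -> y \in subtree p x -> P y.
Proof.
move=> Px clP; rewrite inE => yx.
suff: connect (fun a b => p b == Some a) x y.
  by apply: connect_ind => // a b Pa /eqP /clP; apply.
by have := connect_rev (fun a b => p a == Some b) x y => ->.
Qed.

Lemma subtree_step x y : y \in subtree p x -> y != x ->
  exists2 z, p y = Some z & z \in subtree p x.
Proof.
rewrite inE => /connectP[[|z s] /= + ->]; first by rewrite eqxx.
case/andP=> /eqP pyz sz _; exists z => //.
by rewrite inE; apply/connectP; exists s.
Qed.

Lemma subtree_child x y : y \in subtree p x -> y != x ->
  exists2 c, p c = Some x & y \in subtree p c.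
Proof.
move=> yx ynx.
suff: y = x \/ exists2 c, p c = Some x & y \in subtree p c.
  by case=> // yx'; rewrite yx' eqxx in ynx.
apply: (subtree_ind (P := fun a => a = x \/
  exists2 c, p c = Some x & a \in subtree p c) _ _ yx) => [|a b pab].
  by left.
case=> [<-|[c pc bc]]; right; first by exists a; rewrite ?subtree_refl.
by exists c => //; apply: subtree_trans bc; apply: parent_subtree.
Qed.

(** The parent of a vertex is unique, so the ancestors of z form a chain. *)
Lemma subtree_comparable x y z :
  z \in subtree p x -> z \in subtree p y ->
  x \in subtree p y \/ y \in subtree p x.
Proof.
move=> zx zy; move: zx; rewrite inE.
apply: (connect_ind (P := fun w => w \in subtree p y \/ y \in subtree p w)).
  by left.
move=> a b [ay|ya] /eqP pab; last first.
  by right; apply: subtree_trans ya _; apply: parent_subtree.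
have [<-|nay] := eqVneq a y; first by right; apply: parent_subtree.
by left; have [c] := subtree_step ay nay; rewrite pab => -[->].
Qed.

Definition rooted := exists2 r, p r = None & forall x, x \in subtree p r.

Lemma subtree_root x y : p x = None -> x \in subtree p y -> x = y.
Proof.
move=> px xy; have [//|nxy] := eqVneq x y.
by have [z] := subtree_step xy nxy; rewrite px.
Qed.

(** Two distinct vertices below each other would lie on a cycle of the parent
    function, and no path leaves such a cycle towards the root. *)
Lemma subtree_anti x y :
  rooted -> x \in subtree p y -> y \in subtree p x -> x = y.
Proof.
case=> r pr allr xy yx; have [//|nxy] := eqVneq x y.
(* The property carried down from the root r: a is not on the cycle of x. *)
suff: ~ (x \in subtree p x /\ x \in subtree p x) by rewrite subtree_refl; case.
apply: (subtree_ind (P := fun a => ~ (a \in subtree p x /\ x \in subtree p a))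
         _ _ (allr x)) => [[rx]|a b pab nb [ax xa]].
  have E := subtree_root pr rx; rewrite E in pr.
  by move=> _; move: nxy; rewrite (subtree_root pr xy) eqxx.
apply: nb; split; last by apply: subtree_trans xa (parent_subtree pab).
have [E|nax] := eqVneq a x.
  move: pab; rewrite E => pab; have [c] := subtree_step xy nxy.
  by rewrite pab => -[->] cy; apply: subtree_trans yx.
by have [c] := subtree_step ax nax; rewrite pab => -[->].
Qed.

Lemma parent_neq x y : rooted -> p x = Some y -> x != y.
Proof.
case=> r pr allr pxy; apply/eqP => E; rewrite -E in pxy.
have: x <> x.
  apply: (subtree_ind (P := fun a => a <> x) _ _ (allr x)) => [rx|a b pab].
    by rewrite rx pxy in pr.
  by move=> nbx ax; apply: nbx; move: pab; rewrite ax pxy => -[].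
by [].
Qed.

Lemma parent_notin x y : rooted -> p x = Some y -> y \notin subtree p x.
Proof.
move=> pR pxy; apply/negP => yx; have /eqP[] := parent_neq pR pxy.
exact: (subtree_anti pR (parent_subtree pxy)).
Qed.

(** Comparability separates the subtrees of the children of x from each other,
    and connectivity makes each of them a single component.  Unlike the
    recursive definition of search trees, these conditions speak of subtrees
    only, and so they are easily transported along the constructions below. *)
Definition elimination_tree :=
  [/\ rooted,
      forall x y, adj x y -> x \in subtree p y \/ y \in subtree p x &
      forall x y, y \in subtree p x -> connect (induced_adj (subtree p x)) x y].

End Subtrees.

(** * Search trees are elimination trees *)

Section SearchTreeElimination.
Variable G : sgraph.
Implicit Types (p : {ffun G -> option G}) (A : {set G}).

Lemma search_tree_parent p A q x : search_tree_on p A q -> x \in A ->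
  p x = q \/ exists2 y, y \in A & p x = Some y.
Proof.
move=> pA; elim: pA x => {}A r rA _ IH x xA.
have [->|nxr] := eqVneq x r; [by left | right].
have xB : x \in A :\ r by rewrite !inE nxr.
have xC : x \in component (A :\ r) x by rewrite inE xB connect0.
case: (IH (component (A :\ r) x) _ x xC) => [|px|[y yC px]].
- by apply/imsetP; exists x.
- by exists r.
by exists y => //; move: yC; rewrite !inE => /andP[/andP[]].
Qed.

(** For the induction, A must be connected, and it must be cut off from the
    rest of the tree except at its root: otherwise the subtrees of p, which
    are taken in the whole graph, could contain vertices outside A. *)
Lemma search_tree_on_elim p A q : search_tree_on p A q ->
  (forall x y, p x = Some y -> y \in A -> x \in A) ->
  (forall y, q = Some y -> y \notin A) ->
  (forall x y, x \in A -> y \in A -> connect (induced_adj A) x y) ->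
  [/\ exists r, [/\ r \in A, p r = q & subtree p r = A],
      forall x y, x \in A -> y \in A -> adj x y ->
        x \in subtree p y \/ y \in subtree p x &
      forall x y, x \in A -> y \in subtree p x ->
        connect (induced_adj (subtree p x)) x y].
Proof.
elim=> {}A r rA hC IH clA rnA cA.
pose B := A :\ r.
have prB x : p r = Some x -> x \notin A by apply: rnA.
have compB x : x \in B -> component B x \in components B.
  by move=> xB; apply/imsetP; exists x.
have compxx x : x \in B -> x \in component B x.
  by move=> xB; rewrite inE xB connect0.
have {}IH x : x \in B ->
  [/\ exists r', [/\ r' \in component B x, p r' = Some r &
                      subtree p r' = component B x],
      forall y z, y \in component B x -> z \in component B x -> adj y z ->
        y \in subtree p z \/ z \in subtree p y &
      forall y z, y \in component B x -> z \in subtree p y ->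
        connect (induced_adj (subtree p y)) y z].
  move=> xB; apply: IH; first exact: compB.
  - move=> a b pab bC; have bB : b \in B by move: bC; rewrite inE => /andP[].
    have bA : b \in A by move: bB; rewrite !inE => /andP[].
    have aB : a \in B.
      rewrite !inE (clA _ _ pab bA) andbT; apply/eqP => E.
      by move: (prB b); rewrite -E pab bA => /(_ erefl).
    case: (search_tree_parent (hC _ (compB _ aB)) (compxx _ aB)).
      by move=> pa; move: pa bB; rewrite pab => -[->]; rewrite !inE eqxx.
    case=> c cC pa.
    move: pa cC bC; rewrite pab => -[<-]; rewrite ![_ \in component _ _]inE.
    move=> /andP[_ ab] /andP[_ xb]; rewrite aB /=.
    by apply: connect_trans xb _; rewrite connect_induced_sym.
  - by move=> y [<-]; rewrite !inE eqxx.
  by move=> y z; apply: component_connected.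
have AB x : x \in A -> x != r -> x \in B by move=> xA nxr; rewrite !inE nxr.
have Dr : subtree p r = A.
  apply/setP => x; apply/idP/idP => [xr|xA].
    by apply: (subtree_ind (P := fun a => a \in A) _ _ xr).
  have [->|nxr] := eqVneq x r; first exact: subtree_refl.
  have [[r' [_ pr' Dr']] _ _] := IH x (AB _ xA nxr).
  apply: (@subtree_trans _ _ r'); last exact: parent_subtree.
  by rewrite Dr' compxx // AB.
split; first by exists r.
  move=> x y xA yA xy.
  have [->|nxr] := eqVneq x r; first by right; rewrite Dr.
  have [->|nyr] := eqVneq y r; first by left; rewrite Dr.
  have [_ H _] := IH x (AB _ xA nxr).
  apply: H => //; first by rewrite compxx // AB.
  by rewrite inE AB //= connect1 // /induced_adj /= xy !inE nxr nyr xA yA.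
move=> x y xA; have [->|nxr] := eqVneq x r.
  by rewrite Dr; apply: cA.
have [_ _ H] := IH x (AB _ xA nxr); apply: H.
by rewrite compxx // AB.
Qed.

Lemma search_tree_elimination p :
  connected_graph G -> is_search_tree p -> elimination_tree p.
Proof.
move=> cG pS; have [|//||[r [_ pr Dr]] H2 H3] := search_tree_on_elim pS.
  by move=> x y; rewrite !inE.
  move=> x y _ _; apply: (connect_sub _ (cG x y)) => a b ab.
  by rewrite connect1 // /induced_adj /= !inE.
split; first by exists r => // x; rewrite Dr inE.
  by move=> x y; apply: H2; rewrite inE.
by move=> x y; apply: H3; rewrite inE.
Qed.

(** The subtree of a child c of x is closed under adjacency inside the subtree
    of x without x: a neighbor j that is not in it is, by comparability, a
    proper ancestor of c, and the only one below x is x itself. *)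
Lemma child_subtree_neighbor p c x i j : elimination_tree p -> p c = Some x ->
  i \in subtree p c -> j \in subtree p x -> adj i j ->
  j = x \/ j \in subtree p c.
Proof.
case=> pR H2 _ pc ic jx ij.
case: (H2 _ _ ij) => [ij'|ji]; last by right; apply: subtree_trans ic.
case: (subtree_comparable ic ij') => [cj|jc]; last by right.
have [<-|ncj] := eqVneq c j; first by right; apply: subtree_refl.
have [d] := subtree_step cj ncj; rewrite pc => -[<-] xj.
by left; apply: subtree_anti xj.
Qed.

(** Otherwise the subtree of c would be separated from x in the subtree of x,
    which is connected. *)
Lemma elimination_child_adj p c x : elimination_tree p -> p c = Some x ->
  exists2 y, y \in subtree p c & adj y x.
Proof.
move=> pE pc; have [pR _ H3] := pE.
have [/exists_inP //|/exists_inPn no_adj] :=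
  boolP [exists y in subtree p c, adj y x].
have /negP[] := parent_notin pR pc.
have := H3 _ _ (parent_subtree pc); rewrite connect_induced_sym.
apply: (connect_ind (P := fun a => a \in subtree p c)).
  exact: subtree_refl.
move=> i j ic /and3P[_ jx ij].
case: (child_subtree_neighbor pE pc ic jx ij) => // E.
by move: (no_adj _ ic); rewrite -E ij.
Qed.

(** The components of the subtree of x without x are the subtrees of the
    children of x: these are connected, and closed under adjacency. *)
Lemma elimination_search_tree_on p x :
  elimination_tree p -> search_tree_on p (subtree p x) (p x).
Proof.
move=> pE; have [pR _ H3] := pE.
have [n] := ubnP #|subtree p x|; elim: n x => // n IH x le_n.
apply: SearchTreeOn (subtree_refl p x) _ => C /imsetP[z zB ->].
rewrite -/(component _ _); move: zB; rewrite in_setD1 => /andP[nzx zx].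
have [c pc zc] := subtree_child zx nzx.
have cx := parent_subtree pc.
have xc := parent_notin pR pc.
have cD : subtree p c \subset subtree p x.
  by apply/subsetP => a ac; apply: subtree_trans cx.
suff <- : subtree p c = component (subtree p x :\ x) z.
  rewrite -pc; apply: IH; rewrite -ltnS; apply: leq_trans le_n; rewrite ltnS.
  apply: proper_card; apply/properP; split=> //.
  by exists x; rewrite ?subtree_refl.
have cB a : a \in subtree p c -> a \in subtree p x :\ x.
  move=> ac; rewrite in_setD1 (subsetP cD) // andbT.
  by apply: contraNneq xc => <-.
apply/setP => a; rewrite [in RHS]inE; apply/idP/andP => [ac|[aB za]].
  split; first exact: cB.
  have ca : connect (induced_adj (subtree p c)) z a.
    by apply: connect_trans (H3 _ _ ac); rewrite connect_induced_sym; apply: H3.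
  apply: (connect_sub _ ca) => i j /and3P[ic jc ij].
  by apply: connect1; rewrite /induced_adj [X in is_true X]/= !cB.
apply: (connect_ind (P := fun a => a \in subtree p c)) za => // i j ic.
case/and3P=> _ jB ij; move: jB; rewrite in_setD1 => /andP[njx jx].
case: (child_subtree_neighbor pE pc ic jx ij) => // E.
by rewrite E eqxx in njx.
Qed.

Lemma elimination_tree_search p : elimination_tree p -> is_search_tree p.
Proof.
move=> pE; have [[r pr allr] _ _] := pE.
have := elimination_search_tree_on r pE; rewrite pr /is_search_tree.
by congr (search_tree_on p _ _); apply/setP => x; rewrite allr inE.
Qed.

End SearchTreeElimination.

(** * Rotations and subtrees *)

Section Determination.
Variable G : sgraph.
Implicit Types p : {ffun G -> option G}.

(** The subtree of u is determined by the others: it is the component of u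
    once all the proper ancestors of u are removed, and whether x is a proper
    ancestor of u can be read off the subtree of x. *)
Lemma subtree_sub_off p1 p2 u :
  elimination_tree p1 -> elimination_tree p2 ->
  (forall x, x != u -> subtree p1 x = subtree p2 x) ->
  subtree p1 u \subset subtree p2 u.
Proof.
move=> [p1R _ H1] [_ H2 _] D12; apply/subsetP => y /H1.
apply: (connect_ind (P := fun a => a \in subtree p2 u)).
  exact: subtree_refl.
move=> i j iu /and3P[_ ju ij].
case: (H2 _ _ ij) => [ij'|ji]; last exact: subtree_trans iu.
case: (subtree_comparable iu ij') => // uj.
have [->|nju] := eqVneq j u; first exact: subtree_refl.
by rewrite -D12 // in uj; rewrite (subtree_anti p1R uj ju) eqxx in nju.
Qed.

Lemma subtree_inj p1 p2 : rooted p1 -> rooted p2 ->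
  (forall x, subtree p1 x = subtree p2 x) -> p1 = p2.
Proof.
move=> p1R p2R D12.
have half (q1 q2 : {ffun G -> option G}) x y : rooted q1 -> rooted q2 ->
    (forall x, subtree q1 x = subtree q2 x) -> q1 x = Some y -> q2 x = Some y.
  move=> q1R q2R D qx; have xy := parent_subtree qx.
  have nxy := parent_neq q1R qx.
  rewrite D in xy; have [z q2x zy] := subtree_step xy nxy.
  have xz := parent_subtree q2x; rewrite -D in xz.
  have [w] := subtree_step xz (parent_neq q2R q2x).
  rewrite qx => -[<-]; rewrite D => yz.
  by rewrite q2x (subtree_anti q2R yz zy).
apply/ffunP => x; case E1: (p1 x) => [y|].
  by rewrite (half _ _ _ _ p1R p2R D12 E1).
case E2: (p2 x) => [y|] //.
by rewrite -E1; apply: (half p2 p1) => //.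
Qed.

Lemma elimination_tree_eq_off p1 p2 u :
  elimination_tree p1 -> elimination_tree p2 ->
  (forall x, x != u -> subtree p1 x = subtree p2 x) -> p1 = p2.
Proof.
move=> p1E p2E D12; have [p1R _ _] := p1E; have [p2R _ _] := p2E.
apply: subtree_inj => // x.
have [->|/D12 //] := eqVneq x u.
apply/eqP; rewrite eqEsubset !subtree_sub_off //.
by move=> y /D12.
Qed.

(** What the rotation of v over its parent u does to subtrees. The subtree of
    v in p and that of u in p' are left out: they are forced by the others,
    and without them the relation is symmetric. *)
Definition subtree_swap p p' (u v : G) :=
  [/\ u != v, subtree p u = subtree p' v &
      forall x, x != u -> x != v -> subtree p x = subtree p' x].

Lemma subtree_swap_sym p p' u v :
  subtree_swap p p' u v -> subtree_swap p' p v u.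
Proof.
by case=> nuv E D; split=> [|//|x nxv nxu]; [rewrite eq_sym | rewrite D].
Qed.

Lemma rotate_subtree_swap p u v : p v = Some u -> u != v ->
  subtree_swap p (rotate p u v) u v.
Proof.
move=> pv nuv; pose p' := rotate p u v; rewrite -/p'.
have p'v : p' v = p u by rewrite ffunE eqxx.
have p'u : p' u = Some v by rewrite ffunE (negPf nuv) eqxx.
have p'E x : x != v -> x != u ->
    p' x = p x \/ p x = Some v /\ p' x = Some u.
  move=> nxv nxu; rewrite ffunE (negPf nxv) (negPf nxu).
  by case: ifP => [/andP[/eqP]|]; [right | left].
have vu := parent_subtree pv; have uv' := parent_subtree p'u.
split=> // [|x nxu nxv]; apply/setP => y; apply/idP/idP.
- apply: (subtree_ind (P := fun a => a \in subtree p' v)) => // a b pab bv.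
  have [->|nav] := eqVneq a v; first exact: subtree_refl.
  have [->|nau] := eqVneq a u; first exact: uv'.
  case: (p'E a nav nau) => [|[_]] p'a.
    by apply: subtree_trans bv; apply: parent_subtree; rewrite p'a.
  by apply: subtree_trans uv'; apply: parent_subtree.
- apply: (subtree_ind (P := fun a => a \in subtree p u)) => // a b pab bu.
  have [->|nav] := eqVneq a v; first exact: vu.
  have [->|nau] := eqVneq a u; first exact: subtree_refl.
  case: (p'E a nav nau) => [p'a|[pa _]].
    by apply: subtree_trans bu; apply: parent_subtree; rewrite -p'a.
  by apply: subtree_trans vu; apply: parent_subtree.
- apply: (subtree_ind (P := fun a => a \in subtree p' x)).
    exact: subtree_refl.
  move=> a b pab bx.
  have [Ea|nav] := eqVneq a v.
    move: pab bx; rewrite Ea pv => -[<-] ux.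
    have nux : u != x by rewrite eq_sym.
    by have [z] := subtree_step ux nux; rewrite p'u => -[<-].
  have [Ea|nau] := eqVneq a u.
    rewrite Ea; apply: subtree_trans uv' _; apply: subtree_trans bx.
    by apply: parent_subtree; rewrite p'v -Ea.
  case: (p'E a nav nau) => [|[pa p'a]].
    by rewrite pab => /parent_subtree/subtree_trans; apply.
  move: pab bx; rewrite pa => -[<-] vx.
  apply: subtree_trans (parent_subtree p'a) _.
  exact: subtree_trans uv' vx.
- apply: (subtree_ind (P := fun a => a \in subtree p x)).
    exact: subtree_refl.
  move=> a b pab bx.
  have ux_of_vx : v \in subtree p x -> u \in subtree p x.
    have nvx : v != x by rewrite eq_sym.
    by move=> vx; have [z] := subtree_step vx nvx; rewrite pv => -[<-].
  have [Ea|nav] := eqVneq a v.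
    rewrite Ea; apply: subtree_trans vu _; apply: subtree_trans bx.
    by apply: parent_subtree; rewrite -p'v -Ea.
  have [Ea|nau] := eqVneq a u.
    by move: pab bx; rewrite Ea p'u => -[<-].
  case: (p'E a nav nau) => [|[pa p'a]].
    by rewrite pab => /esym/parent_subtree/subtree_trans; apply.
  move: pab bx; rewrite p'a => -[<-] ux.
  by apply: subtree_trans (parent_subtree pa) (subtree_trans vu ux).
Qed.

End Determination.

(** * Existence of search trees with a prescribed root *)

Section SearchTreeExistence.
Variable G : sgraph.
Implicit Types p : {ffun G -> option G}.

Lemma eq_search_tree_on p p' (A : {set G}) q :
  search_tree_on p A q -> {in A, p =1 p'} -> search_tree_on p' A q.
Proof.
elim=> {}A r rA _ IH pp'; rewrite pp' //; apply: SearchTreeOn => // C CB.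
apply: IH => // x xC; apply: pp'.
by case/imsetP: CB xC => z _ ->; rewrite !inE => /andP[/andP[]].
Qed.

(** Search trees of the components of A without r are chosen by induction and
    glued below r. *)
Lemma search_tree_on_exists (A : {set G}) (r : G) (q : option G) : r \in A ->
  exists2 p, search_tree_on p A q & p r = q.
Proof.
have [n] := ubnP #|A|; elim: n A r q => // n IH A r q le_n rA.
have ltB : #|A :\ r| < n by rewrite (cardsD1 r) rA ltnS in le_n.
pose B := A :\ r.
have IHC (C : {set G}) :
    exists p, C \in components B -> search_tree_on p C (Some r).
  have [/imsetP[z zB ->]|] := boolP (C \in components B); last first.
    by exists [ffun=> None].
  have [||p pC _] := IH (component B z) z (Some r); last by exists p.
    apply: leq_ltn_trans ltB; apply/subset_leq_card/subsetP => y.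
    by rewrite inE => /andP[].
  by rewrite inE zB connect0.
have [F FP] := choice IHC.
pose p := [ffun x => if x == r then q else F (component B x) x].
have pr : p r = q by rewrite ffunE eqxx.
exists p => //; rewrite -pr; apply: SearchTreeOn => // C CB.
apply: eq_search_tree_on (FP C CB) _ => x xC.
case/imsetP: (CB) => z zB EC; move: xC.
rewrite EC -/(component B z) => xC.
have nxr : x != r by move: xC; rewrite !inE; case/andP=> /andP[].
by rewrite ffunE (negPf nxr) (component_eq xC).
Qed.

End SearchTreeExistence.

(** * Rotations that destroy an ancestor relation *)

Section Boundary.
Variable G : sgraph.
Implicit Types p : {ffun G -> option G}.

Lemma is_rotation_swap p p' : rooted p -> is_rotation p p' ->
  exists u v, subtree_swap p p' u v.
Proof.
move=> pR /existsP[u /existsP[v /andP[/eqP pv /eqP ->]]].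
exists u, v; apply: rotate_subtree_swap => //.
by rewrite eq_sym; apply: parent_neq pv.
Qed.

(** In p, the vertex a is above b; in p' it is not. The only subtree that a
    rotation can make smaller is that of the vertex it moves down, so this
    vertex is a, and in p' its parent u is the vertex that took its place. If
    p' has b above a, then b = u, since otherwise b would have the same
    subtree in p, where it is below a. *)
Lemma boundary_swap p p' a b : rooted p -> rooted p' ->
  is_rotation p p' || is_rotation p' p ->
  b \in subtree p a -> b \notin subtree p' a ->
  exists u, [/\ p' a = Some u, subtree_swap p p' a u &
                a \in subtree p' b -> u = b].
Proof.
move=> pR p'R rot ba nba'.
have {rot} [s [t [nst Dst D]]] : exists s t, subtree_swap p p' s t.
  case/orP: rot => /is_rotation_swap; first exact.
  by case=> // u [v /subtree_swap_sym uv]; exists v, u.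
have nba : b != a by apply: contraNneq nba' => ->; apply: subtree_refl.
have Ea : a = s.
  have [//|nas] := eqVneq a s.
  have [Eat|nat] := eqVneq a t; last by rewrite D // (negPf nba') in ba.
  move: nba'; rewrite Eat -Dst => /negP[].
  by apply: subtree_trans ba _; rewrite Dst Eat subtree_refl.
rewrite -{s}Ea in nst Dst D.
have aDt : a \in subtree p' t by rewrite -Dst subtree_refl.
have [z p'a zt] := subtree_step aDt nst.
have Ezt : z = t.
  have [//|nzt] := eqVneq z t.
  have nza : z != a by rewrite eq_sym (parent_neq p'R p'a).
  have := parent_subtree p'a; rewrite -D // => az.
  rewrite -Dst in zt; move: nza.
  by rewrite (subtree_anti pR az zt) eqxx.
exists t; split; [by rewrite p'a Ezt | by [] | move=> ab].
have [//|ntb] := eqVneq t b; rewrite -D // in ab; last by rewrite eq_sym.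
by rewrite (subtree_anti pR ab ba) eqxx in nba.
Qed.

(** By [boundary_swap], p1 and p2 both have, outside u, the subtrees of p'
    with that of a replaced by that of the parent u of a. *)
Lemma boundary_inj p1 p2 p' a b :
  elimination_tree p1 -> elimination_tree p2 -> rooted p' ->
  is_rotation p1 p' || is_rotation p' p1 ->
  is_rotation p2 p' || is_rotation p' p2 ->
  b \in subtree p1 a -> b \in subtree p2 a -> b \notin subtree p' a -> p1 = p2.
Proof.
move=> E1 E2 p'R rot1 rot2 ba1 ba2 nba.
have [R1 _ _] := E1; have [R2 _ _] := E2.
have [u [p'a [_ Du1 D1] _]] := boundary_swap R1 p'R rot1 ba1 nba.
have [u' [+ [_ Du2 D2] _]] := boundary_swap R2 p'R rot2 ba2 nba.
rewrite p'a => -[Eu]; rewrite -{u'}Eu in Du2 D2.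
apply: (elimination_tree_eq_off (u := u)) => // x nxu.
have [->|nxa] := eqVneq x a; first by rewrite Du1 Du2.
by rewrite D1 // D2.
Qed.

End Boundary.

(** * False twins in an elimination tree *)

Section FalseTwinsInTrees.
Variables (G : sgraph) (p : {ffun G -> option G}) (a b : G).
Hypotheses (pE : elimination_tree p) (ab_twins : false_twins a b).

Lemma false_twins_adj x : adj a x = adj b x.
Proof. by move/setP/(_ x): ab_twins; rewrite !inE. Qed.

Lemma false_twins_nonadj : adj a b = false.
Proof. by rewrite adj_sym -false_twins_adj adj_irrefl. Qed.

(** If the subtree of a were larger, it would contain a neighbor n of a by
    connectivity; n is also a neighbor of b, so b would be comparable to n,
    and hence to a. *)
Lemma incomparable_twin_leaf y : a \notin subtree p b -> b \notin subtree p a ->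
  y \in subtree p a -> y = a.
Proof.
move=> nab nba ya; have [//|nya] := eqVneq y a.
have [_ H2 H3] := pE; rewrite eq_sym in nya.
have [n /and3P[_ na an]] := connect_first_step (H3 _ _ ya) nya.
rewrite false_twins_adj in an.
case: (H2 _ _ an) => [bn|nb]; first by rewrite (subtree_trans bn na) in nba.
by case: (subtree_comparable na nb); rewrite ?(negPf nab) ?(negPf nba).
Qed.

(** The subtree of any child c of b contains a neighbor of b, that is, of a;
    this neighbor is comparable to a, and so a is in the subtree of c or c in
    that of a.  Distinct children of b exclude both. *)
Lemma twin_only_child c : p a = Some b -> p c = Some b -> c = a.
Proof.
move=> pa pc; have [//|nca] := eqVneq c a; have [pR H2 _] := pE.
have nacD : a \in subtree p c -> False.
  move=> ac; have nac : a != c by rewrite eq_sym.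
  have [z] := subtree_step ac nac; rewrite pa => -[<-] bc.
  by have := parent_notin pR pc; rewrite bc.
have ncaD : c \in subtree p a -> False.
  move=> ca; have [z] := subtree_step ca nca; rewrite pc => -[<-] ba.
  by have := parent_notin pR pa; rewrite ba.
have [y yc] := elimination_child_adj pE pc.
rewrite adj_sym -false_twins_adj => ay.
case: (H2 _ _ ay) => [a_y|ya]; first by case: nacD; apply: subtree_trans yc.
by case: (subtree_comparable yc ya).
Qed.

(** The subtree of a contains a neighbor of b, and a itself is not one. *)
Lemma twin_child_nonleaf : p a = Some b ->
  exists2 y, y \in subtree p a & y != a.
Proof.
move=> pa; have [y ya yb] := elimination_child_adj pE pa.
by exists y => //; apply: contraTneq yb => ->; rewrite false_twins_nonadj.
Qed.

End FalseTwinsInTrees.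

Lemma false_twins_sym (G : sgraph) (a b : G) :
  false_twins a b -> false_twins b a.
Proof. exact: esym. Qed.

(** The parent w of a is adjacent to a since a is a leaf; then w is adjacent
    to b and thus an ancestor of b. The parent of b is therefore in the
    subtree of w, and the situation is symmetric. *)
Lemma incomparable_twin_parent (G : sgraph) (p : {ffun G -> option G}) a b :
  elimination_tree p -> false_twins a b ->
  a \notin subtree p b -> b \notin subtree p a ->
  exists2 w, p a = Some w & p b = Some w.
Proof.
have one_side (a' b' : G) : elimination_tree p -> false_twins a' b' ->
    a' \notin subtree p b' -> b' \notin subtree p a' ->
    exists w z, [/\ p a' = Some w, p b' = Some z & z \in subtree p w].
  move=> pE ab nab nba; have [pR H2 _] := pE.
  have nab' : a' != b' by apply: contraNneq nab => ->; apply: subtree_refl.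
  have [w pa] : exists w, p a' = Some w.
    case Epa: (p a') => [w|]; first by exists w.
    have [r _ allr] := pR.
    by move: nba; rewrite (subtree_root Epa (allr a')) allr.
  have [y ya yw] := elimination_child_adj pE pa.
  rewrite (incomparable_twin_leaf pE ab nab nba ya) (false_twins_adj ab) in yw.
  have leaf_b z :=
    @incomparable_twin_leaf _ _ _ _ pE (false_twins_sym ab) z nba nab.
  have bw : b' \in subtree p w.
    case: (H2 _ _ yw) => // /leaf_b E.
    by move: nab; rewrite -E (parent_subtree pa).
  have nbw : b' != w.
    by apply: contraNneq nab => ->; apply: parent_subtree.
  by have [z pb zw] := subtree_step bw nbw; exists w, z.
move=> pE ab nab nba; have [pR _ _] := pE.
have [w [z [pa pb zw]]] := one_side _ _ pE ab nab nba.
have [z' [w' [pb' pa' wz]]] := one_side _ _ pE (false_twins_sym ab) nba nab.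
move: pb' pa'; rewrite pa pb => -[Ez] -[Ew]; rewrite -Ez -Ew in wz.
by exists w => //; rewrite (subtree_anti pR zw wz).
Qed.

(** * Removing the new twin from a search tree *)

Section Contraction.
Variables (G : sgraph) (v : G).
Local Notation H := (add_false_twin v).
Implicit Types p : {ffun H -> option H}.

(** Deletion of the new vertex, for trees in which it has at most one child,
    so that no two branches have to be merged. *)
Definition contract p : {ffun G -> option G} :=
  [ffun x => match p (Some x) with
             | Some (Some y) => Some y
             | Some None => obind id (p None)
             | None => None
             end].

Lemma contract_subtree p x y : rooted p ->
  (y \in subtree (contract p) x) = (Some y \in subtree p (Some x)).
Proof.
move=> pR; apply/idP/idP.
  apply: (subtree_ind (P := fun a => Some a \in subtree p (Some x))).
    exact: subtree_refl.
  move=> a b; rewrite ffunE; case pa: (p (Some a)) => [[c|]|] //=.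
    by case=> <-; apply: subtree_trans (parent_subtree pa).
  case pN: (p None) => [[c|]|] //= [<-] cx.
  apply: subtree_trans (parent_subtree pa) _.
  exact: subtree_trans (parent_subtree pN) cx.
pose P (a : H) : Prop := if a is Some a' then a' \in subtree (contract p) x
  else exists2 c, p None = Some (Some c) & c \in subtree (contract p) x.
suff: forall a : H, a \in subtree p (Some x) -> P a by move/(_ (Some y)).
move=> a; apply: (subtree_ind (P := P)); first exact: subtree_refl.
case=> [c|] [d|] pc /=.
- by apply: subtree_trans (parent_subtree _); rewrite ffunE pc.
- case=> e pN; apply: subtree_trans (parent_subtree _).
  by rewrite ffunE pc pN.
- by move=> dx; exists d.
by have := parent_neq pR pc; rewrite eqxx.
Qed.

(** The trees outside the cut set that an edge of its boundary can reach: v is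
    a child of the new vertex, or the two are incomparable. *)
Definition contractible p :=
  (None \notin subtree p (Some v)) /\
  (p (Some v) = Some None \/ Some v \notin subtree p None).

Lemma twins_SomeNone : @false_twins H (Some v) None.
Proof. exact: add_false_twinP. Qed.

(** The new vertex connects a subtree only through neighbors of v, and v can
    play this role in its place provided that it lies in the same subtree. *)
Lemma contractible_below p x : elimination_tree p -> contractible p ->
  None \in subtree p (Some x) -> Some v \in subtree p (Some x).
Proof.
move=> pE [nNv [pv|nvN]] Nx.
  exact: subtree_trans (parent_subtree pv) Nx.
have [w pv pN] := incomparable_twin_parent pE twins_SomeNone nvN nNv.
apply: subtree_trans (parent_subtree pv) _.
by have [//|z] := subtree_step Nx; rewrite pN => -[<-].
Qed.

Lemma contractible_root p : elimination_tree p -> contractible p ->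
  rooted (contract p).
Proof.
move=> pE pC; have [pR _ _] := pE; have [[r|] pr allr] := pR.
  by exists r => [|x]; rewrite ?contract_subtree // ffunE pr.
have [nNv [pv|]] := pC; last by rewrite allr.
exists v => [|x]; first by rewrite ffunE pv pr.
rewrite contract_subtree //.
have [//|c pc xc] := subtree_child (allr (Some x)).
by rewrite -(twin_only_child pE twins_SomeNone pv pc).
Qed.

(** Folding the new vertex onto v is a graph homomorphism from H to G; it maps
    each connected subtree of p onto the corresponding one of the
    contraction. *)
Lemma contract_elimination p : elimination_tree p -> contractible p ->
  elimination_tree (contract p).
Proof.
move=> pE pC; have [pR H2 H3] := pE.
split; first exact: contractible_root.
  by move=> x y xy; rewrite !contract_subtree //; apply: H2.
move=> x y; rewrite contract_subtree // => yx.
pose f (a : H) : G := if a is Some a' then a' else v.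
have fD a : a \in subtree p (Some x) -> f a \in subtree (contract p) x.
  by case: a => [a|] /= ax; rewrite contract_subtree ?contractible_below.
have := connect_homo (f := f) _ (H3 _ _ yx); apply=> a b.
case/and3P=> /fD ax /fD bx ab; apply: connect1.
rewrite /induced_adj /= ax bx /=.
by case: a b ab {ax bx} => [a|] [b|] //=; rewrite adj_sym.
Qed.

(** The two ways to insert the new vertex: as a second copy of the leaf v, or
    between v and its parent. Each of them undoes [contract] on the trees of
    the corresponding shape. *)
Definition expand_leaf (q : {ffun G -> option G}) : {ffun H -> option H} :=
  [ffun a : H => omap Some (q (odflt v a))].

Definition expand_above (q : {ffun G -> option G}) : {ffun H -> option H} :=
  [ffun a : H => if a == Some v then Some None else omap Some (q (odflt v a))].

Lemma incomparable_contract_leaf p x : elimination_tree p ->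
  None \notin subtree p (Some v) -> Some v \notin subtree p None ->
  x \in subtree (contract p) v -> x = v.
Proof.
move=> pE nNv nvN; have [pR _ _] := pE; rewrite contract_subtree // => xv.
by case: (incomparable_twin_leaf pE twins_SomeNone nvN nNv xv).
Qed.

Lemma above_contract_nonleaf p : elimination_tree p ->
  None \notin subtree p (Some v) -> p (Some v) = Some None ->
  exists2 x, x \in subtree (contract p) v & x != v.
Proof.
move=> pE nNv pv; have [pR _ _] := pE.
have [[x|] xv nxv] := twin_child_nonleaf pE twins_SomeNone pv.
  by exists x; rewrite ?contract_subtree.
by rewrite xv in nNv.
Qed.

Lemma expand_leafK p : elimination_tree p ->
  None \notin subtree p (Some v) -> Some v \notin subtree p None ->
  expand_leaf (contract p) = p.
Proof.
move=> pE nNv nvN; have [pR _ _] := pE.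
have [w pv pN] := incomparable_twin_parent pE twins_SomeNone nvN nNv.
have pSome x : omap Some (contract p x) = p (Some x) :> option H.
  rewrite ffunE; case px: (p (Some x)) => [[y|]|] //=.
  have xN := parent_subtree px.
  have NSome := false_twins_sym twins_SomeNone.
  by have := incomparable_twin_leaf pE NSome nNv nvN xN.
apply/ffunP=> -[x|]; rewrite ffunE [odflt _ _]/= pSome //.
by rewrite pv pN.
Qed.

Lemma expand_aboveK p : elimination_tree p -> p (Some v) = Some None ->
  expand_above (contract p) = p.
Proof.
move=> pE pv; have [pR _ _] := pE.
apply/ffunP=> a; rewrite ffunE.
have [->|nav] := eqVneq a (Some v); first by rewrite pv.
case: a nav => [x|] nav; rewrite ffunE /=.
  case px: (p (Some x)) => [[y|]|] //=.
  by rewrite (twin_only_child pE twins_SomeNone pv px) eqxx in nav.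
rewrite pv; case pN: (p None) => [[y|]|] //=.
by have := parent_neq pR pN; rewrite eqxx.
Qed.

(** Whether v is a leaf of the contraction tells how the new vertex was
    placed, and hence which of the two expansions recovers the tree. *)
Lemma contract_inj p1 p2 : elimination_tree p1 -> elimination_tree p2 ->
  contractible p1 -> contractible p2 -> contract p1 = contract p2 -> p1 = p2.
Proof.
have mixed (q1 q2 : {ffun H -> option H}) :
    elimination_tree q1 -> elimination_tree q2 ->
    None \notin subtree q1 (Some v) -> None \notin subtree q2 (Some v) ->
    q1 (Some v) = Some None -> Some v \notin subtree q2 None ->
    contract q1 = contract q2 -> False.
  move=> E1 E2 nNv1 nNv2 q1v nvN2 q12.
  have [x] := above_contract_nonleaf E1 nNv1 q1v.
  rewrite q12 => xv; rewrite (incomparable_contract_leaf E2 nNv2 nvN2 xv).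
  by rewrite eqxx.
move=> E1 E2 [nNv1 [p1v|nvN1]] [nNv2 [p2v|nvN2]] p12.
- by rewrite -(expand_aboveK E1 p1v) p12 expand_aboveK.
- by case: (mixed p1 p2).
- by case: (mixed p2 p1).
by rewrite -(expand_leafK E1 nNv1 nvN1) p12 expand_leafK.
Qed.

(** The new vertex is attached to H by a neighbor of v, which exists as G is
    connected and has a second vertex. *)
Lemma add_false_twin_connected :
  connected_graph G -> 2 <= #|G| -> connected_graph H.
Proof.
move=> cG G2.
have [w vw] : exists w, adj v w.
  have [x nxv] := exists_neq v G2.
  by rewrite eq_sym in nxv; apply: connect_first_step (cG v x) nxv.
have cS : forall x y : G, connect (@adj H) (Some x) (Some y).
  move=> x y; have := connect_homo (f := Some : G -> H) _ (cG x y); apply.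
  by move=> a b ab; apply: connect1.
have symH := sym_connect_sym (@adj_sym H).
have cN (x : G) : connect (@adj H) None (Some x).
  by apply: connect_trans (cS w x); apply: connect1.
case=> [x|] [y|] //.
by rewrite symH.
Qed.

(** * Adding the new twin as a root *)

Definition add_root (q : {ffun G -> option G}) : {ffun H -> option H} :=
  [ffun a : H => if a is Some x then
                   if q x is Some y then Some (Some y) else Some None
                 else None].

Lemma add_root_subtree q (x y : G) :
  (Some y \in subtree (add_root q) (Some x)) = (y \in subtree q x).
Proof.
apply/idP/idP.
  pose P (a : H) : Prop := if a is Some a' then a' \in subtree q x else False.
  apply: (subtree_ind (P := P)); first exact: subtree_refl.
  move=> [a|] [b|]; rewrite ffunE //=.
  case qa: (q a) => [c|] //= [<-].
  by apply: subtree_trans (parent_subtree _).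
apply: (subtree_ind (P := fun a => Some a \in subtree (add_root q) (Some x))).
  exact: subtree_refl.
move=> a b qa; apply: subtree_trans (parent_subtree _).
by rewrite ffunE qa.
Qed.

Lemma add_root_subtreeN q (x : G) : None \notin subtree (add_root q) (Some x).
Proof. by apply/negP => /subtree_step[//|z]; rewrite ffunE. Qed.

Lemma add_root_elimination q : connected_graph H ->
  elimination_tree q -> elimination_tree (add_root q).
Proof.
move=> cH [[r qr allr] H2 H3].
have allN a : a \in subtree (add_root q) None.
  case: a => [x|]; last exact: subtree_refl.
  apply: (@subtree_trans H _ (Some r)); first by rewrite add_root_subtree.
  by apply: parent_subtree; rewrite ffunE qr.
split; first by exists None; rewrite ?ffunE.
  move=> [x|] [y|] xy; rewrite ?allN; [|by left|by right|by left].
  by rewrite !add_root_subtree; apply: H2.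
move=> [x|] a.
  case: a => [y|]; last by rewrite (negPf (add_root_subtreeN q x)).
  rewrite add_root_subtree => yx.
  have := connect_homo (f := Some : G -> H) _ (H3 _ _ yx); apply=> c d.
  case/and3P=> cx dx cd; apply: connect1.
  by rewrite /induced_adj [X in is_true X]/= !add_root_subtree cx dx.
move=> _; apply: connect_sub (cH None a) => c d cd.
by apply: connect1; rewrite /induced_adj [X in is_true X]/= !allN.
Qed.

Lemma add_root_inj : injective add_root.
Proof.
move=> q1 q2 E; apply/ffunP => x; move/ffunP/(_ (Some x)): E.
by rewrite !ffunE; case: (q1 x) (q2 x) => [y|] [z|] //= [->].
Qed.

(** * Exchanging the twins *)

Definition swap_twins (a : H) : H :=
  if a == Some v then None else if a is Some x then Some x else Some v.

Lemma swap_twinsK : involutive swap_twins.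
Proof.
move=> [x|]; rewrite /swap_twins /=; last by rewrite eqxx.
by have [->|/negPf ->] := eqVneq (Some x) (Some v).
Qed.

Lemma swap_twins_adj (a b : H) : adj (swap_twins a) (swap_twins b) = adj a b.
Proof.
have swapS x : swap_twins (Some x) = if x == v then None else Some x by [].
case: a b => [x|] [y|]; rewrite ?swapS //=.
- have [->|_] := eqVneq x v; have [->|_] := eqVneq y v => //=.
  by rewrite adj_irrefl.
- by have [->|_] := eqVneq x v.
- by have [->|_] := eqVneq y v.
by rewrite adj_irrefl.
Qed.

End Contraction.

Section Relabel.
Variables (G : sgraph) (f : G -> G).
Hypotheses (fK : involutive f) (f_adj : forall x y, adj (f x) (f y) = adj x y).

Definition relabel (p : {ffun G -> option G}) : {ffun G -> option G} :=
  [ffun x => omap f (p (f x))].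

Lemma relabelK : involutive relabel.
Proof.
move=> p; apply/ffunP => x; rewrite !ffunE fK.
by case: (p x) => //= y; rewrite fK.
Qed.

Lemma relabel_subtree p x y :
  (f y \in subtree (relabel p) (f x)) = (y \in subtree p x).
Proof.
have half q a b : b \in subtree q a -> f b \in subtree (relabel q) (f a).
  apply: (subtree_ind (P := fun b => f b \in subtree (relabel q) (f a))).
    exact: subtree_refl.
  move=> c d qc; apply: subtree_trans (parent_subtree _).
  by rewrite ffunE fK qc.
apply/idP/idP; last exact: half.
by move/half; rewrite relabelK !fK.
Qed.

Lemma relabel_elimination p :
  elimination_tree p -> elimination_tree (relabel p).
Proof.
case=> [[r pr allr] H2 H3]; split.
- exists (f r) => [|x]; first by rewrite ffunE fK pr.
  by rewrite -[x]fK relabel_subtree.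
- move=> x y; rewrite -[x]fK -[y]fK f_adj !relabel_subtree; apply: H2.
move=> x y; rewrite -[x]fK -[y]fK relabel_subtree => yx.
have := connect_homo (f := f) _ (H3 _ _ yx); apply=> a b.
case/and3P=> ax bx ab; apply: connect1.
by rewrite /induced_adj [X in is_true X]/= !relabel_subtree ax bx f_adj.
Qed.

End Relabel.

(** * Counting the trees on both sides of the cut *)

Definition search_trees (G : sgraph) : {set {ffun G -> option G}} :=
  [set p | `[< is_search_tree p >]].

Lemma card_rotation_graph (G : sgraph) :
  #|rotation_graph G| = #|search_trees G|.
Proof. by rewrite cardsE /= card_sig. Qed.

Lemma mem_search_trees (G : sgraph) (p : {ffun G -> option G}) :
  elimination_tree p -> p \in search_trees G.
Proof. by move=> pE; rewrite inE; apply/asboolP/elimination_tree_search. Qed.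

Lemma search_treesP (G : sgraph) (p : {ffun G -> option G}) :
  connected_graph G -> p \in search_trees G -> elimination_tree p.
Proof.
by move=> cG; rewrite inE => /asboolP; apply: search_tree_elimination.
Qed.

Lemma val_search_tree (G : sgraph) (T : search_tree G) :
  val T \in search_trees G.
Proof. by case: T => p pS; rewrite inE. Qed.

Definition tree_of (G : sgraph) (p : {ffun G -> option G})
    (pE : elimination_tree p) : search_tree G :=
  exist (fun p => `[< is_search_tree p >]) p
    (asboolT (elimination_tree_search pE)).

Section Cut.
Variables (G : sgraph) (v : G).
Hypotheses (cG : connected_graph G) (G2 : 2 <= #|G|).
Local Notation H := (add_false_twin v).

Let cH : connected_graph H.
Proof. exact: add_false_twin_connected. Qed.

Let treeE (T : search_tree H) : elimination_tree (val T).
Proof. exact/search_treesP/val_search_tree. Qed.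

Definition old_above_new : {set rotation_graph H} :=
  [set T : search_tree H | None \in subtree (val T) (Some v)].

Definition new_above_old : {set rotation_graph H} :=
  [set T : search_tree H | Some v \in subtree (val T) None].

Definition incomparable : {set rotation_graph H} :=
  [set T : search_tree H | (None \notin subtree (val T) (Some v)) &&
                           (Some v \notin subtree (val T) None)].

Lemma new_old_disjoint (T : search_tree H) :
  Some v \in subtree (val T) None -> None \notin subtree (val T) (Some v).
Proof.
have [pR _ _] := treeE T; move=> vN; apply/negP => Nv.
by have := subtree_anti pR vN Nv.
Qed.

Lemma card_old_new : #|old_above_new| = #|new_above_old|.
Proof.
pose s (T : search_tree H) := tree_of
  (relabel_elimination (@swap_twinsK _ v) (@swap_twins_adj _ v) (treeE T)).
have sK : involutive s.
  by move=> T; apply: val_inj; rewrite /= relabelK //; apply: swap_twinsK.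
rewrite -(card_imset _ (inv_inj sK)); apply: eq_card => T.
have swapN : swap_twins (Some v) = None :> H by rewrite /swap_twins eqxx.
have swapS : swap_twins None = Some v :> H by [].
have sT (a b : H) (U : search_tree H) :
    (swap_twins a \in subtree (val (s U)) (swap_twins b)) =
    (a \in subtree (val U) b).
  by rewrite relabel_subtree //; apply: swap_twinsK.
rewrite -[T in LHS]sK mem_imset; last exact: inv_inj.
rewrite [LHS]inE [RHS]inE -[LHS]sT sK.
by rewrite swapN swapS.
Qed.

Lemma card_cut : #|rotation_graph H| = 2 * #|old_above_new| + #|incomparable|.
Proof.
rewrite -(cardsC old_above_new) mul2n -addnn -addnA; congr (_ + _).
rewrite -(cardsID new_above_old) [in RHS]card_old_new; congr (_ + _).
  apply: eq_card => T; rewrite in_setI in_setC; apply: andb_idl.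
  by have := @new_old_disjoint T; rewrite !inE.
by apply: eq_card => T; rewrite !inE andbC.
Qed.

(** Contraction embeds the incomparable trees into the search trees on G in
    which v is a leaf; a search tree with root v is not one of these. *)
Lemma incomparable_lt : #|incomparable| < #|rotation_graph G|.
Proof.
rewrite card_rotation_graph.
pose f (T : rotation_graph H) := contract (val (T : search_tree H)).
have f_inj : {in incomparable &, injective f}.
  move=> T1 T2; rewrite ![_ \in incomparable]inE.
  move=> /andP[n1 n1'] /andP[n2 n2'] E.
  apply: val_inj; apply: (contract_inj (treeE T1) (treeE T2)) E.
    by split; [exact: n1 | right].
  by split; [exact: n2 | right].
rewrite -(card_in_imset f_inj); apply: proper_card; apply/properP; split.
  apply/subsetP => q /imsetP[T]; rewrite [_ \in incomparable]inE.
  move=> /andP[n1 n1'] ->.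
  apply: mem_search_trees; apply: contract_elimination (treeE T) _.
  by split; [exact: n1 | right].
have [p pS pv] := search_tree_on_exists (None : option G) (in_setT v).
have pT : p \in search_trees G by rewrite inE; apply/asboolP.
exists p => //; apply/imsetP => -[T]; rewrite [_ \in incomparable]inE.
move=> /andP[n1 n1'] Ep.
have [[r pr allr] _ _] := search_treesP cG pT.
have Ev := subtree_root pv (allr v).
have [x nxv] := exists_neq v G2.
case/eqP: nxv; apply: (incomparable_contract_leaf (treeE T) n1 n1').
by move: (allr x); rewrite -Ev Ep.
Qed.

(** Adding the new vertex as a root embeds R(G) into the other side of the
    cut, which has the same size. *)
Lemma rotation_graph_le : #|rotation_graph G| <= #|old_above_new|.
Proof.
rewrite card_old_new card_rotation_graph -(card_imset _ (@add_root_inj G v)).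
pose f (T : rotation_graph H) := val (T : search_tree H).
have f_inj : injective f by apply: val_inj.
rewrite -(card_imset new_above_old f_inj).
apply/subset_leq_card/subsetP => p /imsetP[q /(search_treesP cG) qE ->].
have pE := add_root_elimination cH qE.
apply/imsetP; exists (tree_of pE) => //.
have [[r _ allr] _ _] := pE.
have qN : add_root v q None = None by rewrite ffunE.
by rewrite [_ \in new_above_old]inE (subtree_root qN (allr None)) allr.
Qed.

Lemma old_above_new_boundaryP (T T' : search_tree H) :
  (T, T') \in edge_boundary old_above_new ->
  [/\ None \in subtree (val T) (Some v), None \notin subtree (val T') (Some v)
     & is_rotation (val T) (val T') || is_rotation (val T') (val T)].
Proof.
by rewrite inE => /and3P[]; rewrite ![_ \in old_above_new]inE.
Qed.

(** A boundary edge is mapped to the contraction of its end outside the cut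
    set. *)
Lemma edge_boundary_le : #|edge_boundary old_above_new| <= #|rotation_graph G|.
Proof.
pose f (e : rotation_graph H * rotation_graph H) :=
  contract (val (e.2 : search_tree H)).
have contrE (e : rotation_graph H * rotation_graph H) :
    e \in edge_boundary old_above_new ->
    contractible (val (e.2 : search_tree H)).
  case: e => T T' /old_above_new_boundaryP[vN nvN rot].
  have [pR _ _] := treeE T; have [p'R _ _] := treeE T'.
  have [u [pv _ uN]] := boundary_swap pR p'R rot vN nvN.
  split=> //; have [/uN E|] := boolP (Some v \in _); last by right.
  by left; rewrite pv E.
have f_inj : {in edge_boundary old_above_new &, injective f}.
  move=> [T1 T1'] [T2 T2'] e1 e2 E.
  have ET : T1' = T2'.
    apply: val_inj; apply: (contract_inj (treeE T1') (treeE T2')) E.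
      exact: contrE e1.
    exact: contrE e2.
  move: e1 e2; rewrite -{}ET => /old_above_new_boundaryP[v1 nv rot1].
  case/old_above_new_boundaryP=> v2 _ rot2.
  congr (_, _); apply: val_inj.
  have [p'R _ _] := treeE T1'.
  exact: boundary_inj (treeE T1) (treeE T2) p'R rot1 rot2 v1 v2 nv.
rewrite card_rotation_graph -(card_in_imset f_inj).
apply/subset_leq_card/subsetP => q /imsetP[e eB ->].
apply: mem_search_trees; exact: contract_elimination (treeE _) (contrE _ eB).
Qed.

End Cut.

Local Open Scope ring_scope.

Theorem theorem4 (G : sgraph) (v : G) :
  connected_graph G -> (2 <= #|G|)%N ->
  edge_expansion (rotation_graph (add_false_twin v)) <
    (2 * #|rotation_graph G|%:R) /
      (#|rotation_graph (add_false_twin v)|%:R - #|rotation_graph G|%:R) :> rat.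
Proof.
move=> cG G2; set H := rotation_graph (add_false_twin v).
have nE := card_cut v cG G2.
have c_lt := incomparable_lt v cG G2.
have r_le := rotation_graph_le v cG G2.
have d_le := edge_boundary_le v cG G2.
move: nE c_lt r_le d_le; rewrite -/H.
set A := old_above_new v; set c := #|incomparable v|.
set r := #|rotation_graph G|.
move=> nE c_lt r_le d_le.
have r0 : (0 < r)%N by apply: leq_ltn_trans c_lt.
have A0 : (0 < #|A|)%N by apply: leq_trans r_le.
have nr : (r < #|H|)%N.
  by rewrite nE mul2n -addnn -addn1 -addnA leq_add // (leq_trans A0) ?leq_addr.
have AS : expansion_set A.
  by rewrite /expansion_set -card_gt0 A0 nE leq_addr.
have [_ /(_ _ AS)] := edge_expansionP (leq_ltn_trans r0 nr).
move=> /le_lt_trans; apply; rewrite /expansion_ratio.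
rewrite -natrB ?(ltnW nr) // ltr_pdivlMr ?ltr0n ?subn_gt0 // mulrAC.
rewrite ltr_pdivrMr ?ltr0n // -!natrM ltr_nat.
apply: (@leq_ltn_trans (r * (#|H| - r))); first by rewrite leq_mul2r d_le orbT.
(* As c < r, the denominator #|H| - r is less than #|H| - c = 2 * #|A|. *)
rewrite mulnAC mulnC ltn_pmul2r // ltn_subLR ?(ltnW nr) // nE addnC.
by rewrite ltn_add2r.
Qed.
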